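(* Let $\alpha,\beta\in\mathbb{N}$, let $\vec p=(p_1,\dots,p_\alpha)$ and $\vec q=(q_1,\dots,q_\beta)$ be stochastic vectors, and let $F=[f_{rs}]$ be an $\alpha\times\beta$ matrix with $0\le f_{rs}\le 1$ for all $r,s$ (the edge distribution matrix). For each environment $\omega\in\Omega=\Omega_W\times\Omega_M$, let $(G_{n,\omega})_{n\ge 1}$ be the associated sequence of inhomogeneous random bipartite graphs in the random environment $\omega$, as defined in the context. If the entries of $F$ are strictly positive, then for $\mu_W\times\mu_M$-almost every environment $\omega\in\Omega$, $$\lim_{n\to\infty}\left(\frac{\mathbb{E}_{n,\omega}\left(\mathrm{pm}(G_{n,\omega})\right)}{n!}\right)^{1/n}=\mathrm{sm}_{\vec p,\vec q}(F).$$
   Context: A stochastic vector is a vector with non-negative entries summing to $1$. Space of environments. Endow $\{1,\dots,\alpha\}$ with the probability measure $P_W(\{i\})=p_i$, let $\Omega_W=\prod_{i=1}^{\infty}\{1,\dots,\alpha\}$ and let $\mu_W$ be the corresponding (infinite) product measure. Likewise endow $\{1,\dots,\beta\}$ with the probability measure giving mass $q_j$ to $j$, let $\Omega_M=\prod_{j=1}^{\infty}\{1,\dots,\beta\}$ and let $\mu_M$ be the corresponding product measure. The space of environments is $\Omega=\Omega_W\times\Omega_M$ with the product measure $\mu_W\times\mu_M$. An environment $\omega\in\Omega$ thus consists of two sequences $(w_1(\omega),w_2(\omega),\dots)\in\Omega_W$ and $(m_1(\omega),m_2(\omega),\dots)\in\Omega_M$. Random graphs. For $\omega\in\Omega$ and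 $i,j\ge 1$ put $a_{(ij)}(\omega)=f_{w_i(\omega)\,m_j(\omega)}\in[0,1]$. Given $\omega$, let $X_{\omega,(ij)}$ be independent random variables, with $X_{\omega,(ij)}=1$ with probability $a_{(ij)}(\omega)$ and $X_{\omega,(ij)}=0$ with probability $1-a_{(ij)}(\omega)$. For $n\ge1$, $G_{n,\omega}$ is the random bipartite graph with the two disjoint vertex classes $(w_1(\omega),\dots,w_n(\omega))$ and $(m_1(\omega),\dots,m_n(\omega))$, each regarded as $n$ distinct vertices indexed by $1,\dots,n$ (even if some of the values coincide), in which the $i$-th vertex of the first class and the $j$-th vertex of the second class are joined by an edge if and only if $X_{\omega,(ij)}=1$. The law of $G_{n,\omega}$ is denoted $\mathbb{P}_{n,\omega}$, and $\mathbb{E}_{n,\omega}$ denotes expectation with respect to $\mathbb{P}_{n,\omega}$ (with $\omega$ fixed). Perfect matchings. A perfect matching of a graph is a subset of edges containing every vertex exactly once; $\mathrm{pm}(G)$ denotes the number of perfect matchings of $G$. Thus $\mathrm{pm}(G_{n,\omega})=\sum_{\sigma\in S_n}\prod_{i=1}^n X_{\omega,(i\,\sigma(i))}$, where $S_n$ is the group of permutations of $\{1,\dots,n\}$. Scaling mean. For an $\alpha\times\beta$ matrix $F=[f_{rs}]$ with non-negative entries and stochastic vectors $\vec p=(p_1,\dots,p_\alpha)$ and $\vec q=(q_1,\dots,q_\beta)$, $$\mathrm{sm}_{\vec p,\vec q}(F)=\inf\left(\prod_{r=1}^{\alpha}x_r^{-p_r}\right)\left(\prod_{s=1}^{\beta}y_s^{-q_s}\right)\left(\sum_{r=1}^{\alpha}\sum_{s=1}^{\beta}x_r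 f_{rs}y_s\,p_r q_s\right),$$ where the infimum is taken over all vectors $(x_r)\in\mathbb{R}^\alpha$ and $(y_s)\in\mathbb{R}^\beta$ with strictly positive entries. *)

(* Defs.v *)
From HB Require Import structures.
From mathcomp Require Import all_boot all_order all_algebra finmap.
From mathcomp Require Import all_classical all_reals all_analysis.

Set Implicit Arguments.
Unset Strict Implicit.
Unset Printing Implicit Defensive.

Import Order.TTheory GRing.Theory Num.Theory.
Import numFieldNormedType.Exports.

Local Open Scope classical_set_scope.
Local Open Scope ring_scope.

Definition stochastic (R : realType) (n : nat) (p : 'rV[R]_n) : Prop :=
  (forall i, 0 <= p 0 i) /\ \sum_i p 0 i = 1.

(* The library's measurable types are pointed, hence the nonempty alphabets
   'I_k.+1.  Sequences are indexed from 0. *)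
HB.instance Definition _ (k : nat) := isPointed.Build 'I_k.+1 ord0.

Definition coordinate_events (k : nat) : set (set (nat -> 'I_k.+1)) :=
  [set [set w | w i = c] | i in [set: nat] & c in [set: 'I_k.+1]].

Definition seq_space (k : nat) := g_sigma_algebraType (@coordinate_events k).

(* Characterizes mu uniquely: measurable rectangles form a pi-system that
   generates the product sigma-algebra. *)
Definition is_product_measure (R : realType) (k : nat) (p : 'rV[R]_k.+1)
    (mu : probability (seq_space k) R) : Prop :=
  forall (n : nat) (A : nat -> {set 'I_k.+1}),
    mu [set w | forall i, (i < n)%N -> w i \in A i] =
    (\prod_(i < n) \sum_(c in A i) p 0 c)%:E.

Definition environment (k l : nat) : Type := (seq_space k * seq_space l)%type.

Definition edge_prob (R : realType) (k l : nat) (F : 'M[R]_(k.+1, l.+1))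
    (w : environment k l) (i j : nat) : R := F (w.1 i) (w.2 j).

Definition mutually_independent d d' (T : measurableType d)
    (T' : measurableType d') (R : realType) (P : probability T R)
    (I : choiceType) (X : I -> {RV P >-> T'}) : Prop :=
  forall (J : {fset I}) (B : I -> set T'), (forall i, measurable (B i)) ->
    P [set t | forall i, i \in J -> B i (X i t)] =
    (\prod_(i <- J) P (X i @^-1` B i))%E.

(* A finite simple graph on V is given by its set of edges, each edge being a
   2-element subset of V. *)
Definition perfect_matching (V : finType) (E M : {set {set V}}) : bool :=
  (M \subset E) && [forall v, #|[set e in M | v \in e]%SET| == 1%N].

Definition pm (V : finType) (E : {set {set V}}) : nat :=
  #|[set M | perfect_matching E M]%SET|.

Definition bipartite_graph (n : nat) (x : nat * nat -> bool) :
    {set {set ('I_n + 'I_n)}} :=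
  [set [set inl ij.1; inr ij.2] | ij : 'I_n * 'I_n & x (val ij.1, val ij.2)]%SET.

Definition expected_pm d (T : measurableType d) (R : realType)
    (P : probability T R) (X : nat * nat -> {RV P >-> bool}) (n : nat) : \bar R :=
  ('E_P[fun t => (pm (bipartite_graph n (fun ij => X ij t)))%:R])%E.

Definition scaling_mean (R : realType) (m n : nat) (p : 'rV[R]_m)
    (q : 'rV[R]_n) (F : 'M[R]_(m, n)) : R :=
  inf [set (\prod_r (xy.1 0 r) `^ (- p 0 r)) * (\prod_s (xy.2 0 s) `^ (- q 0 s))
           * \sum_r \sum_s xy.1 0 r * F r s * xy.2 0 s * p 0 r * q 0 s
      | xy in [set xy : 'rV[R]_m * 'rV[R]_n |
                (forall r, 0 < xy.1 0 r) /\ (forall s, 0 < xy.2 0 s)]].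

(* Main.v *)
Require Import Defs.
From mathcomp Require Import all_boot all_order all_algebra finmap.
From mathcomp Require Import all_classical all_reals all_analysis.
From mathcomp Require Import fingroup perm measurable_realfun.
From mathcomp Require Import ring lra.

(** Given the environment, the expected number of perfect matchings is the
    permanent of [F (w i) (v j)].  For [y > 0] put [W r = \sum_s F r s * q s * y s]
    and [pi r s = F r s * q s * y s / W r].  Since
    [F r s = pi r s * W r / (q s * y s)], the permanent divided by [n!] equals
    exactly [(\prod_i W (w i) / \prod_j y (v j)) * (P_pi / P_q)], where [P_pi] and
    [P_q] are the probabilities that independent letters, drawn from
    [pi (w i)], respectively from [q], form a rearrangement of [v 0 ... v (n-1)].
    The first factor grows like the [n]-th power of the objective of the scaling
    mean (already minimized over [x]).  A probability of this kind is
    not exponentially small as soon as the expected letter counts are close to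
    the required ones: by a Chernoff bound the counts are typically nearly right, and
    resampling a small fraction of the letters repairs them.  This holds for [q]
    by the law of large numbers, whence the upper bound for every [y]; it holds for
    [pi] when [y] nearly minimizes the objective, because the column marginals
    [\sum_r p r * pi r s] are then close to [q s]. *)

Set Implicit Arguments.
Unset Strict Implicit.
Unset Printing Implicit Defensive.

Import Order.TTheory GRing.Theory Num.Theory.
Import numFieldNormedType.Exports.

Local Open Scope ring_scope.

(** * Product laws on words *)

(** Probabilities of events about independent letters, the [i]-th drawn from [rho i], are finite
    sums of these weights, so this part needs no measure space. *)
Definition product_weight (R : realType) (I S : finType) (rho : I -> S -> R)
  (f : {ffun I -> S}) : R := \prod_i rho i (f i).

Definition occ (I S : finType) (f : {ffun I -> S}) (s : S) : nat :=
  \sum_i (f i == s).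

Definition rearrangement (I S : finType) (f g : {ffun I -> S}) : bool :=
  [forall s, occ f s == occ g s].

Definition stochastic_kernel (R : realType) (I S : finType) (rho : I -> S -> R) :=
  (forall i s, 0 <= rho i s) /\ (forall i, \sum_s rho i s = 1).

Section ProductWeight.
Variables (R : realType) (I S : finType).
Implicit Types (rho : I -> S -> R) (f g psi : {ffun I -> S}).

Lemma product_weight_ge0 rho f : (forall i s, 0 <= rho i s) ->
  0 <= product_weight rho f.
Proof. by move=> h; apply: prodr_ge0. Qed.

(** The expectation of a product of independent factors. It computes both the exponential moment in
    [chernoff_occ] and the image of the product law under resampling. *)
Lemma sum_product_weightM rho (h : I -> S -> R) :
  \sum_f product_weight rho f * \prod_i h i (f i) =
  \prod_i \sum_s rho i s * h i s.
Proof.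
by rewrite bigA_distr_bigA; apply: eq_bigr => f _; rewrite -big_split.
Qed.

Lemma sum_product_weight rho : stochastic_kernel rho ->
  \sum_f product_weight rho f = 1.
Proof.
move=> [_ h1]; transitivity (\prod_i \sum_s rho i s); last by rewrite big1.
by rewrite bigA_distr_bigA.
Qed.

(** [expR (- t) >= 1 - t] gives [expR t <= 1 / (1 - t)], and [(1 - t) * (1 + t + 2 * t ^+ 2) = 1 + t
    ^+ 2 * (1 - 2 * t) >= 1]. *)
Lemma expR_le_quadratic (t : R) : 0 <= t <= 2^-1 -> expR t <= 1 + t + 2 * t ^+ 2.
Proof.
move=> t01; have ht : 0 < 1 - t by lra.
have h : expR t * (1 - t) <= 1.
  rewrite mulrC -ler_pdivlMr ?expR_gt0// div1r -expRN; exact: expR_ge1Dx.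
by rewrite -(ler_pM2r ht); apply: (le_trans h); nra.
Qed.

(** Exponential Markov inequality with parameter [t = e / 4]: the exponent is at most
    [(2 * t ^+ 2 - t * e) * #|I|%:R], and [2 * t ^+ 2 - t * e = - (e ^+ 2 / 8)]. *)
Lemma chernoff_occ rho (s : S) (e : R) : stochastic_kernel rho -> 0 <= e <= 1 ->
  \sum_(f | \sum_i rho i s + e * #|I|%:R <= (occ f s)%:R) product_weight rho f
    <= expR (- (e ^+ 2 / 8 * #|I|%:R)).
Proof.
move=> [rho0 rho1] e01.
set m := \sum_i rho i s; set t := e / 4.
have t01 : 0 <= t <= 2^-1 by rewrite /t; lra.
apply: (@le_trans _ _ (\sum_f product_weight rho f *
    expR (t * ((occ f s)%:R - (m + e * #|I|%:R))))).
  rewrite [leRHS](bigID (fun f => m + e * #|I|%:R <= (occ f s)%:R))/=.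
  rewrite -[leLHS]addr0 lerD//; last first.
    by apply: sumr_ge0 => f _; rewrite mulr_ge0 ?expR_ge0 ?product_weight_ge0.
  apply: ler_sum => f hf; rewrite ler_peMr ?product_weight_ge0//.
  rewrite -[leLHS]expR0 ler_expR mulr_ge0 ?subr_ge0//.
  by case/andP: t01.
under eq_bigr => f _.
  rewrite mulrBr expRD /occ natr_sum mulr_sumr expR_sum mulrA. over.
rewrite -mulr_suml (sum_product_weightM rho (fun _ s' => expR (t * (s' == s)%:R))).
(* Each factor of the moment is [1 + rho i s * (expR t - 1)], and [1 + u <= expR u]. *)
apply: (@le_trans _ _ (expR (\sum_i rho i s * (expR t - 1)) *
    expR (- (t * (m + e * #|I|%:R))))).
  rewrite ler_pM2r ?expR_gt0// expR_sum; apply: ler_prod => i _.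
  apply/andP; split; first by apply: sumr_ge0 => s' _; rewrite mulr_ge0 ?expR_ge0.
  apply: le_trans (expR_ge1Dx _); rewrite (bigD1 s)//= eqxx mulr1.
  under eq_bigr => s' /negbTE -> do rewrite mulr0 expR0 mulr1.
  by have := rho1 i; rewrite (bigD1 s)//= => /eqP; nra.
rewrite -expRD ler_expR -mulr_suml -/m.
have m0 : 0 <= m by apply: sumr_ge0.
have mn : m <= #|I|%:R.
  rewrite -sum1_card natr_sum; apply: ler_sum => i _.
  by rewrite -(rho1 i) (bigD1 s)//= lerDl sumr_ge0.
have := expR_le_quadratic t01; set E := expR t => hE.
have h1 : m * (E - 1 - t) <= #|I|%:R * (2 * t ^+ 2).
  apply: ler_pM => //; last lra.
  by have := expR_ge1Dx t; rewrite -/E; lra.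
have -> : e = 4 * t by rewrite /t; field.
by move: h1; set n := #|I|%:R; nra.
Qed.

Lemma sum_occ_lt_ge rho (e : R) : stochastic_kernel rho -> 0 <= e <= 1 ->
  1 - #|S|%:R * expR (- (e ^+ 2 / 8 * #|I|%:R)) <=
  \sum_(f | [forall s, (occ f s)%:R < \sum_i rho i s + e * #|I|%:R])
     product_weight rho f.
Proof.
move=> rhoK e01; 
pose good (f : {ffun I -> S}) := [forall s, (occ f s)%:R < \sum_i rho i s + e * #|I|%:R].
rewrite lerBlDr -{1}(sum_product_weight rhoK) (bigID good)/= lerD2l.
(* Union bound over the letter that is too frequent. *)
apply: (@le_trans _ _ (\sum_s \sum_(f | \sum_i rho i s + e * #|I|%:R <= (occ f s)%:R)
   product_weight rho f)).
  under [leRHS]eq_bigr do rewrite big_mkcond.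
  rewrite exchange_big/= big_mkcond; apply: ler_sum => f _.
  have w0 : 0 <= product_weight rho f by apply: product_weight_ge0; case: rhoK.
  case: ifPn => [|_]; last by apply: sumr_ge0 => s _; case: ifP.
  rewrite /good negb_forall => /existsP[s]; rewrite -leNgt => hs.
  by rewrite (bigD1 s)//= hs lerDl; apply: sumr_ge0 => s' _; case: ifP.
apply: (le_trans (ler_sum _ (fun s _ => chernoff_occ s rhoK e01))).
by rewrite sumr_const mulr_natl.
Qed.

Lemma sum_occ f : (\sum_s occ f s = #|I|)%N.
Proof.
rewrite /occ exchange_big/= -sum1_card; apply: eq_bigr => i _.
by rewrite (bigD1 (f i))//= eqxx big1 ?addn0// => s; rewrite eq_sym => /negbTE ->.
Qed.

(** Induction on the total excess. Both words have the same length, so if their counts differ, some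
    letter [s] is in excess and some [s'] is lacking; turning one [s] into [s'] lowers the
    excess. *)
Lemma close_rearrangement f psi : exists2 g, rearrangement g psi &
  (\sum_i (f i != g i) <= \sum_s (occ f s - occ psi s))%N.
Proof.
have [N] := ubnP (\sum_s (occ f s - occ psi s))%N.
elim: N f => // N IH f; rewrite ltnS => fN.
have [/forallP fpsi|] := boolP (rearrangement f psi).
  by exists f; [exact/forallP|rewrite big1// => i _; rewrite eqxx].
have [s hs|h] := pickP (fun s => occ psi s < occ f s)%N; last first.
  rewrite /rearrangement negb_forall => /existsP[s sP].
  have : (\sum_s occ f s < \sum_s occ psi s)%N.
    rewrite (bigD1 s)//= [ltnRHS](bigD1 s)//= -addSn leq_add//.
      by rewrite ltn_neqAle sP leqNgt h.
    by apply: leq_sum => s' _; rewrite leqNgt h.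
  by rewrite !sum_occ ltnn.
have [s' hs'|h] := pickP (fun s => occ f s < occ psi s)%N; last first.
  have : (\sum_s occ psi s < \sum_s occ f s)%N.
    rewrite (bigD1 s)//= [ltnRHS](bigD1 s)//= -addSn leq_add//.
    by apply: leq_sum => s' _; rewrite leqNgt h.
  by rewrite !sum_occ ltnn.
move=> _.
have ss' : s != s'.
  by apply/eqP => ss'; move: hs hs'; rewrite ss' => /ltnW; rewrite leqNgt => /negbTE ->.
have [i fi] : exists i, f i == s.
  apply/existsP; rewrite -[X in is_true X]negbK negb_exists; apply/negP => /forallP h.
  by move: hs; rewrite /occ [X in (_ < X)%N]big1// => i _; rewrite (negbTE (h i)).
pose f1 : {ffun I -> S} := [ffun j => if j == i then s' else f j].
have occf1 u : (occ f1 u + (u == s) = occ f u + (u == s'))%N.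
  rewrite /occ (bigD1 i)//= [in RHS](bigD1 i)//= ffunE eqxx (eqP fi).
  under eq_bigr => j /negbTE ji do rewrite ffunE ji.
  by rewrite ![_ == u]eq_sym addnC addnA [RHS]addnAC.
have drop : (\sum_u (occ f1 u - occ psi u) < \sum_u (occ f u - occ psi u))%N.
  rewrite (bigD1 s)//= [ltnRHS](bigD1 s)//= -addSn leq_add//.
    have := occf1 s; rewrite eqxx (negbTE ss') addn0 addn1 => <-.
    rewrite subSn//; have := occf1 s; rewrite eqxx (negbTE ss') addn0 addn1 => E.
    by move: hs; rewrite -E ltnS.
  apply: leq_sum => u us; have := occf1 u; rewrite (negbTE us) addn0 => ->.
  have [->|_] := eqVneq u s'; last by rewrite addn0.
  by rewrite addn1 (eqP (_ : _ - _ == 0)%N)// subn_eq0.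
have [g gpsi hg] := IH f1 (leq_trans drop fN).
exists g => //; apply: leq_trans drop; rewrite -addn1.
apply: leq_trans (leq_add hg (leqnn 1)).
rewrite (bigD1 i)//= [X in (_ <= X + _)%N](bigD1 i)//= addnC.
rewrite -addnA addnCA leq_add//.
  by apply: leq_sum => j /negbTE ji; rewrite ffunE ji.
by rewrite addnC; case: (_ != _); case: (_ != _).
Qed.

Lemma occ_rearrangement_gt0 f g i : rearrangement f g -> (0 < occ g (f i))%N.
Proof. by move=> /forallP/(_ (f i))/eqP <-; rewrite /occ (bigD1 i)//= eqxx. Qed.

(* Resampling each letter from [rho] independently with probability [z] is a
   kernel [K] that leaves the product law invariant, and from a word with nearly
   correct letter counts it reaches a rearrangement of [psi] by resampling few
   letters. *)
Lemma rearrangement_weight_ge rho psi (z c e : R) :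
  stochastic_kernel rho -> 0 <= e <= 1 -> 0 < z < 1 -> 0 < c <= 1 ->
  (forall i s, (0 < occ psi s)%N -> c <= rho i s) ->
  (forall s, \sum_i rho i s <= (occ psi s)%:R + e * #|I|%:R) ->
  (1 - #|S|%:R * expR (- (e ^+ 2 / 8 * #|I|%:R))) *
    expR ((ln (1 - z) + ln (z * c) * (2 * #|S|%:R * e)) * #|I|%:R) <=
  \sum_(g | rearrangement g psi) product_weight rho g.
Proof.
move=> rhoK e01 z01 c01 hc hocc; have [rho0 rho1] := rhoK.
pose K f g := \prod_i ((1 - z) * (f i == g i)%:R + z * rho i (g i)).
have K0 f g : 0 <= K f g.
  by apply: prodr_ge0 => i _; rewrite addr_ge0 ?mulr_ge0//; lra.
have stat g : product_weight rho g = \sum_f product_weight rho f * K f g.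
  rewrite (sum_product_weightM rho (fun i s => (1 - z) * (s == g i)%:R + z * rho i (g i))).
  apply: eq_bigr => i _.
  under eq_bigr do rewrite mulrDr.
  rewrite big_split/= -mulr_suml rho1 (bigD1 (g i))//= eqxx big1; first by rewrite mulr1n; ring.
  by move=> s /negbTE ->; rewrite !mulr0.
under [leRHS]eq_bigr do rewrite stat.
rewrite exchange_big/=.
under [leRHS]eq_bigr do rewrite -mulr_sumr.
apply: le_trans (ler_wpM2r (expR_ge0 _) (sum_occ_lt_ge rhoK e01)) _.
rewrite mulr_suml.
rewrite [leRHS](bigID (fun f => [forall s, (occ f s)%:R < \sum_i rho i s + e * #|I|%:R]))/=.
rewrite -[leLHS]addr0 lerD//; last first.
  by apply: sumr_ge0 => f _; rewrite mulr_ge0 ?product_weight_ge0 ?sumr_ge0.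
apply: ler_sum => f /forallP fgood; rewrite ler_wpM2l ?product_weight_ge0//.
have [g gpsi fg] := close_rearrangement f psi.
rewrite (bigD1 g)//= -[leLHS]addr0 lerD ?sumr_ge0//.
(* Each letter is in excess by at most [2 * e * #|I|%:R]: one half comes from the typicality of [f],
   the other from [hocc]. *)
have D : (\sum_i (f i != g i))%:R <= 2 * #|S|%:R * e * #|I|%:R.
  apply: (le_trans (_ : _ <= (\sum_s (occ f s - occ psi s))%:R)); first by rewrite ler_nat.
  rewrite natr_sum; apply: (@le_trans _ _ (\sum_(s : S) (2 * e * #|I|%:R))).
    apply: ler_sum => s _; have := fgood s; have := hocc s.
    have [le|le] := leqP (occ psi s) (occ f s).
      by rewrite natrB//; lra.
    move=> _ _; rewrite (eqP (_ : _ - _ == 0)%N) ?subn_eq0 1?ltnW//.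
    by rewrite !mulr_ge0//; lra.
  by rewrite sumr_const -[X in X <= _]mulr_natl; lra.
have zc0 : 0 < z * c by rewrite mulr_gt0//; lra.
have zc1 : ln (z * c) <= 0 by rewrite ln_le0 ?mulr_ile1//; lra.
(* A kept letter has factor at least [1 - z], a changed one at least [z * c]. Charging [1 - z] at
   changed positions as well only lowers the bound. *)
apply: (@le_trans _ _ (\prod_i expR (ln (1 - z) + ln (z * c) * (f i != g i)%:R))).
  rewrite -expR_sum ler_expR big_split/= sumr_const -mulr_sumr -natr_sum.
  rewrite -[X in _ <= X + _]mulr_natl.
  have := ler_wnM2l zc1 D; lra.
apply: ler_prod => i _; rewrite expR_ge0/=.
have [_|_] := eqVneq (f i) (g i); rewrite /= ?mulr0 ?addr0 ?mulr1 ?add0r.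
  by rewrite lnK ?posrE ?subr_gt0; [rewrite lerDl mulr_ge0//|]; lra.
rewrite expRD !lnK ?posrE//; last by lra.
have := hc i (g i) (occ_rearrangement_gt0 i gpsi); nra.
Qed.

End ProductWeight.

(** The loss [d] is split into thirds, for the kept letters, the changed letters and the Chernoff
    prefactor. The tolerance [e] and the threshold [N] depend only on [S], [c] and [d], so they can
    be fixed before the laws and the word. *)
Lemma rearrangement_weight_ge_exp (R : realType) (S : finType) (c d : R) :
  0 < c <= 1 -> 0 < d -> exists2 e, 0 < e & exists N : R,
  forall (I : finType) (rho : I -> S -> R) (psi : {ffun I -> S}),
  N <= #|I|%:R ->
  stochastic_kernel rho ->
  (forall i s, (0 < occ psi s)%N -> c <= rho i s) ->
  (forall s, \sum_i rho i s <= (occ psi s)%:R + e * #|I|%:R) ->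
  expR (- d * #|I|%:R) <= \sum_(g | rearrangement g psi) product_weight rho g.
Proof.
move=> c01 d0.
pose z := 1 - expR (- (d / 3)).
have z01 : 0 < z < 1.
  have : expR (- (d / 3)) < 1 by rewrite expR_lt1; lra.
  by have := expR_gt0 (- (d / 3)); rewrite /z; lra.
have lnz : ln (1 - z) = - (d / 3) by rewrite /z opprB addrC subrK expRK.
pose b := - ln (z * c).
have b0 : 0 <= b by rewrite /b oppr_ge0 ln_le0// mulr_ile1//; lra.
(* With [e <= d / M] the changed letters cost at most [2 * #|S|%:R * e * b <= d / 3]; the [+ 1]
   keeps [M] positive. *)
pose M : R := 6 * #|S|%:R * b + 1.
have Sb0 : 0 <= #|S|%:R * b by rewrite mulr_ge0.
pose e := Num.min 1 (d / M).
have M0 : 0 < M by rewrite /M; nra.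
have e0 : 0 < e by rewrite lt_min ltr01 divr_gt0.
have e1 : e <= 1 by rewrite ge_min lexx.
have eM : e * M <= d by rewrite -ler_pdivlMr// ge_min lexx orbT.
(* The first term of the threshold brings [expR (- (d / 3 * n))] below one half, the second keeps
   the prefactor above one half. *)
exists e => //; exists (3 / d + 16 * #|S|%:R / e ^+ 2) => I rho psi IN rhoK hc hocc.
have e01 : 0 <= e <= 1 by rewrite ltW.
apply: le_trans (rearrangement_weight_ge rhoK e01 z01 c01 hc hocc).
have expN (x : R) : 0 <= x -> expR (- x) * (1 + x) <= 1.
  move=> x0; rewrite expRN ler_pdivrMl ?expR_gt0// mulr1; exact: expR_ge1Dx.
set n : R := #|I|%:R in IN *.
have e20 : 0 < e ^+ 2 by rewrite exprn_gt0.
have dn : 3 <= d * n.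
  have : 3 / d <= n by apply: le_trans IN; rewrite lerDl !mulr_ge0 ?invr_ge0// ltW.
  by rewrite ler_pdivrMr// mulrC.
have en : 16 * #|S|%:R <= e ^+ 2 * n.
  have : 16 * #|S|%:R / e ^+ 2 <= n.
    by apply: le_trans IN; rewrite lerDr mulr_ge0 ?invr_ge0// ltW.
  by rewrite ler_pdivrMr// [n * _]mulrC.
have h1 : expR (- (d / 3 * n)) <= 2^-1.
  have := expN (d / 3 * n); have := expR_ge0 (- (d / 3 * n)).
  by set E := expR _; nra.
have h2 : #|S|%:R * expR (- (e ^+ 2 / 8 * n)) <= 2^-1.
  have := expN (e ^+ 2 / 8 * n); have := expR_ge0 (- (e ^+ 2 / 8 * n)).
  set E := expR _ => E0 h.
  have {}h : E * (1 + e ^+ 2 / 8 * n) <= 1 by apply: h; nra.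
  have : E * (2 * #|S|%:R) <= E * (e ^+ 2 / 8 * n) by rewrite ler_wpM2l//; lra.
  nra.
apply: le_trans (ler_wpM2r (expR_ge0 _) (_ : expR (- (d / 3 * n)) <= _)); last first.
  by apply: (le_trans h1); lra.
rewrite -expRD ler_expR lnz -[ln (z * c)]opprK -/b.
have : b * (2 * #|S|%:R * e) <= d / 3.
  move: eM; rewrite /M; nra.
have : 0 <= n by exact: ler0n.
nra.
Qed.

(** * Permanents and rearrangements *)

Definition permute (n : nat) (S : finType) (psi : {ffun 'I_n -> S})
  (sigma : 'S_n) : {ffun 'I_n -> S} := [ffun i => psi (sigma i)].

Lemma rearrangementP (n : nat) (S : finType) (g psi : {ffun 'I_n -> S}) :
  reflect (exists tau, g = permute psi tau) (rearrangement g psi).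
Proof.
apply: (iffP idP) => [/forallP gpsi|[tau ->]]; last first.
  apply/forallP => s; rewrite /occ [X in _ == X](reindex_inj (@perm_inj _ tau)).
  by apply/eqP; apply: eq_bigr => i _; rewrite ffunE.
have occE (f : {ffun 'I_n -> S}) s : count_mem s [tuple f i | i < n] = occ f s.
  rewrite /= -map_comp/= count_map -sum1_count/= big_mkcond/=.
  by rewrite /occ -big_enum; apply: eq_bigr => i _ /=; case: eqP.
have /tuple_permP[tau E] : perm_eq [tuple g i | i < n] [tuple psi i | i < n].
  by apply/allP => s _ /=; rewrite !occE; exact: gpsi.
exists tau; apply/ffunP => i; rewrite ffunE.
have : tnth [tuple g i | i < n] i = tnth [tuple tnth [tuple psi i | i < n] (tau i) | i < n] i.
  by congr tnth; exact: val_inj.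
by rewrite !tnth_mktuple.
Qed.

(** The fibres of [permute psi] are cosets of the stabilizer of [psi], so all of them have its
    cardinality. *)
Lemma sum_permute (R : realType) (n : nat) (S : finType) (psi : {ffun 'I_n -> S})
    (H : {ffun 'I_n -> S} -> R) :
  \sum_(sigma : 'S_n) H (permute psi sigma) =
  #|[pred sigma | permute psi sigma == psi]|%:R *
    \sum_(g | rearrangement g psi) H g.
Proof.
rewrite (partition_big (permute psi) (fun g => rearrangement g psi))/=; last first.
  by move=> sigma _; apply/rearrangementP; exists sigma.
rewrite mulr_sumr; apply: eq_bigr => g /rearrangementP[tau ->].
rewrite (eq_bigr (fun=> H (permute psi tau))); last by move=> sigma /eqP ->.
rewrite (reindex_inj (mulgI tau)) (eq_bigl (fun sigma => permute psi sigma == psi)).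
  by rewrite sumr_const mulr_natl.
move=> sigma; apply/eqP/eqP => /ffunP h; apply/ffunP => i.
  by have := h (tau^-1 i)%g; rewrite !ffunE permM permKV.
by have := h (tau i); rewrite !ffunE permM.
Qed.

(* Both sums over permutations exceed the corresponding sums over rearrangements
   by the same factor, the number of permutations fixing [psi]. *)
Lemma permanent_ratio (R : realType) (n : nat) (S : finType)
    (psi : {ffun 'I_n -> S}) (rho : 'I_n -> S -> R) (x : 'I_n -> R) (q y : S -> R) :
  (forall j, 0 < q (psi j)) ->
  (\sum_(sigma : 'S_n) \prod_i
     (rho i (psi (sigma i)) * x i / (q (psi (sigma i)) * y (psi (sigma i))))) / (n`!)%:R =
  (\sum_(g | rearrangement g psi) product_weight rho g) /
  (\sum_(g | rearrangement g psi) product_weight (fun=> q) g) *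
  ((\prod_i x i) / \prod_j y (psi j)).
Proof.
move=> q0; set N := (#|[pred sigma | permute psi sigma == psi]|%:R : R).
have N0 : N != 0.
  rewrite pnatr_eq0 -lt0n; apply/card_gt0P; exists 1%g.
  by rewrite !inE; apply/eqP/ffunP => i; rewrite ffunE perm1.
have qpsi : \prod_j q (psi j) != 0 by apply/prodf_neq0 => j _; rewrite gt_eqF.
(* This is [sum_permute] for the constant law [q], under which all rearrangements of [psi] have the
   same weight. *)
have fq : (n`!)%:R * \prod_j q (psi j) =
    N * \sum_(g | rearrangement g psi) product_weight (fun=> q) g.
  rewrite -sum_permute -card_Sn mulr_natl -sumr_const.
  apply: eq_bigr => sigma _.
  rewrite /product_weight (reindex_inj (@perm_inj _ sigma)).
  by apply: eq_bigr => i _; rewrite ffunE.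
have n0 : (n`!)%:R != 0 :> R by rewrite pnatr_eq0 -lt0n fact_gt0.
have Pq0 : \sum_(g | rearrangement g psi) product_weight (fun=> q) g != 0.
  by apply: contra_neq (mulf_neq0 n0 qpsi) => E; rewrite fq E mulr0.
(* The product of the denominators does not depend on [sigma] and leaves the sum. *)
transitivity ((\sum_(sigma : 'S_n) product_weight rho (permute psi sigma)) *
    \prod_i x i / \prod_j (q (psi j) * y (psi j)) / (n`!)%:R).
  congr (_ / _); rewrite !mulr_suml; apply: eq_bigr => sigma _.
  rewrite [X in _ / X](reindex_inj (@perm_inj _ sigma)) -prodfV -!big_split/=.
  by apply: eq_bigr => i _; rewrite ffunE.
rewrite sum_permute.
rewrite big_split/= invfM.
have -> : (n`!)%:R^-1 = (\prod_j q (psi j)) /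
    (N * \sum_(g | rearrangement g psi) product_weight (fun=> q) g) :> R.
  by rewrite -fq invfM mulrCA mulfV ?mulr1.
rewrite invfM.
move: qpsi; set Q := \prod_j q _ => qpsi.
set Y := (\prod_i y _)^-1; rewrite -/N.
by field; rewrite N0 qpsi Pq0.
Qed.

(** * The scaling mean *)

Section LogScalingMean.
Variables (R : realType) (m n : nat).
Variables (p : 'rV[R]_m) (q : 'rV[R]_n) (F : 'M[R]_(m, n)).
Hypotheses (pS : stochastic p) (qS : stochastic q).
Hypothesis F01 : forall r s, 0 < F r s <= 1.

Let p0 r : 0 <= p 0 r. Proof. by case: pS. Qed.
Let q0 s : 0 <= q 0 s. Proof. by case: qS. Qed.
Let p1 : \sum_r p 0 r = 1. Proof. by case: pS. Qed.
Let q1 : \sum_s q 0 s = 1. Proof. by case: qS. Qed.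

(** [weighted_row] and [row_law] are the [W] and [pi] of the overview. *)
Definition weighted_row (y : 'I_n -> R) (r : 'I_m) := \sum_s F r s * q 0 s * y s.

(* The logarithm of the expression in [scaling_mean] once it has been minimized
   over [x], the minimum being at [x_r = 1 / weighted_row y r]. *)
Definition log_objective (y : 'I_n -> R) :=
  \sum_r p 0 r * ln (weighted_row y r) - \sum_s q 0 s * ln (y s).

Definition row_law (y : 'I_n -> R) (r : 'I_m) (s : 'I_n) :=
  F r s * q 0 s * y s / weighted_row y r.

(** The limiting frequency of [s] among letters drawn from the laws of rows that themselves occur
    with frequencies [p]. *)
Definition col_marginal (y : 'I_n -> R) (s : 'I_n) :=
  \sum_r p 0 r * row_law y r s.

Lemma stochastic_sum_gt0 (k : nat) (a : 'rV[R]_k) (x : 'I_k -> R) : stochastic a ->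
  (forall i, 0 < x i) -> 0 < \sum_i a 0 i * x i.
Proof.
move=> [a0 a1] x0.
rewrite lt_neqAle sumr_ge0 ?andbT => [|i _]; last by rewrite mulr_ge0// ltW.
apply/eqP => /esym/eqP; rewrite psumr_eq0 => [|i _]; last by rewrite mulr_ge0// ltW.
move=> /allP h; have := oner_neq0 R; rewrite -a1 big1 ?eqxx// => i _.
have /h : i \in index_enum 'I_k by rewrite mem_index_enum.
by rewrite /= mulf_eq0 (gt_eqF (x0 i)) orbF => /eqP.
Qed.

(** Jensen's inequality for [ln], from [ln u <= u - 1] at [u = x i / M], with [M] the mean. *)
Lemma sum_mul_ln_le (k : nat) (a : 'rV[R]_k) (x : 'I_k -> R) : stochastic a ->
  (forall i, 0 < x i) -> \sum_i a 0 i * ln (x i) <= ln (\sum_i a 0 i * x i).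
Proof.
move=> aS x0; have := stochastic_sum_gt0 aS x0; case: aS => a0 a1.
set M := \sum_i a 0 i * x i => M0.
rewrite -subr_le0 -[ln M]mul1r -a1 mulr_suml -sumrB.
apply: (@le_trans _ _ (\sum_i (a 0 i * x i / M - a 0 i))).
  apply: ler_sum => i _; rewrite -mulrBr -ln_div ?posrE//.
  have xM : 0 < x i / M by rewrite divr_gt0.
  have := le_ln1Dx (_ : -1 < x i / M - 1); rewrite addrCA subrr addr0 => h.
  by rewrite -mulrA -[X in _ - X]mulr1 -mulrBr ler_wpM2l// h//; lra.
by rewrite sumrB -mulr_suml a1 divff ?gt_eqF// subrr.
Qed.

Lemma entry_lower_bound : exists2 c : R, 0 < c <= 1 & forall r s, c <= F r s.
Proof.
(* Starting the minimum at [1] gives [c <= 1] and covers an empty matrix. *)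
exists (\big[Num.min/1]_(rs : 'I_m * 'I_n) F rs.1 rs.2).
  by rewrite bigmin_le_id andbT lt_bigmin// => -[r s] _; case/andP: (F01 r s).
by move=> r s; exact: (@bigmin_le _ _ _ _ (r, s) (fun rs => F rs.1 rs.2)).
Qed.

Section Positive.
Variables (y : 'I_n -> R) (y0 : forall s, 0 < y s).

Let qy_ge0 : forall s, 0 <= q 0 s * y s.
Proof. by move=> s; rewrite mulr_ge0// ltW. Qed.

Let qy_gt0 : 0 < \sum_s q 0 s * y s.
Proof. exact: stochastic_sum_gt0. Qed.

Lemma weighted_row_ge (c : R) r : (forall r s, c <= F r s) ->
  c * (\sum_s q 0 s * y s) <= weighted_row y r.
Proof.
move=> cF; rewrite mulr_sumr; apply: ler_sum => s _.
by rewrite -mulrA ler_wpM2r.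
Qed.

Lemma weighted_row_le r : weighted_row y r <= \sum_s q 0 s * y s.
Proof.
apply: ler_sum => s _.
by rewrite -mulrA ler_piMl//; case/andP: (F01 r s).
Qed.

Lemma weighted_row_gt0 r : 0 < weighted_row y r.
Proof.
have [c /andP[c0 c1] cF] := entry_lower_bound.
by apply: lt_le_trans (weighted_row_ge r cF); rewrite mulr_gt0.
Qed.

Lemma row_law_ge0 r s : 0 <= row_law y r s.
Proof.
have := F01 r s => /andP[/ltW F0 _].
by rewrite /row_law divr_ge0 ?mulr_ge0//; apply: ltW; rewrite ?weighted_row_gt0.
Qed.

Lemma sum_row_law r : \sum_s row_law y r s = 1.
Proof. by rewrite /row_law -mulr_suml divff// gt_eqF// weighted_row_gt0. Qed.

Lemma sum_col_marginal : \sum_s col_marginal y s = 1.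
Proof.
rewrite /col_marginal exchange_big/= -p1; apply: eq_bigr => r _.
by rewrite -mulr_sumr sum_row_law mulr1.
Qed.

(** The entries of [F] lie between [c] and [1], so replacing row [r'] by row [r] costs at most a
    factor [c] in the entry and another in [weighted_row]; then average over [r'] with weights
    [p]. *)
Lemma row_law_ge (c : R) r s : 0 < c -> (forall r s, c <= F r s) ->
  c ^+ 2 * col_marginal y s <= row_law y r s.
Proof.
move=> c0 cF; rewrite -[leRHS]mul1r -p1 mulr_suml mulr_sumr.
apply: ler_sum => r' _; rewrite mulrCA ler_wpM2l//.
rewrite /row_law mulrA ler_pdivrMr ?weighted_row_gt0// [leRHS]mulrAC.
rewrite ler_pdivlMr ?weighted_row_gt0//.
have := weighted_row_ge r' cF; have := weighted_row_le r.
have := weighted_row_gt0 r; have := weighted_row_gt0 r'.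
set W := weighted_row y r; set W' := weighted_row y r'; set Z := \sum_s _.
move=> W'0 W0 WZ ZW'.
have /andP[F'0 F'1] := F01 r' s.
have cW : c * W <= W' by apply: le_trans ZW'; rewrite ler_wpM2l// ltW.
have h : c * F r' s <= F r s by apply: le_trans (cF r s); rewrite ler_piMr// ltW.
have h2 : (c * F r' s) * (c * W) <= F r s * W'.
  by apply: ler_pM => //; rewrite mulr_ge0// ltW.
by rewrite -!(mulrA (F _ _)); have := ler_wpM2r (qy_ge0 s) h2; congr (_ <= _); ring.
Qed.

(** Every weighted row is at least [c] times the [q]-mean of [y], and Jensen bounds the subtracted
    term by the logarithm of that mean. *)
Lemma ln_le_log_objective (c : R) : 0 < c -> (forall r s, c <= F r s) ->
  ln c <= log_objective y.
Proof.
move=> c0 cF; rewrite /log_objective lerBrDr.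
apply: le_trans (lerD (lexx _) (sum_mul_ln_le qS y0)) _.
rewrite -lnM ?posrE// -[leLHS]mul1r -p1 mulr_suml.
apply: ler_sum => r _; rewrite ler_wpM2l// ler_ln ?posrE ?mulr_gt0 ?weighted_row_gt0//.
exact: weighted_row_ge.
Qed.

End Positive.

Let admissible := [set xy : 'rV[R]_m * 'rV[R]_n |
  (forall r, 0 < xy.1 0 r) /\ (forall s, 0 < xy.2 0 s)]%classic.

Let objective (xy : 'rV[R]_m * 'rV[R]_n) :=
  (\prod_r (xy.1 0 r) `^ (- p 0 r)) * (\prod_s (xy.2 0 s) `^ (- q 0 s))
           * \sum_r \sum_s xy.1 0 r * F r s * xy.2 0 s * p 0 r * q 0 s.

Let prod_powRN k (a x : 'rV[R]_k) : (forall i, 0 < x 0 i) ->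
  \prod_i (x 0 i) `^ (- a 0 i) = expR (- \sum_i a 0 i * ln (x 0 i)).
Proof.
move=> x0; rewrite -sumrN expR_sum; apply: eq_bigr => i _.
by rewrite /powR gt_eqF// mulNr.
Qed.

Let objectiveE x y : admissible (x, y) -> objective (x, y) =
  expR (- \sum_r p 0 r * ln (x 0 r)) * expR (- \sum_s q 0 s * ln (y 0 s)) *
  \sum_r p 0 r * (x 0 r * weighted_row (y 0) r).
Proof.
move=> [/= x0 y0]; rewrite /objective/= !prod_powRN//; congr (_ * _).
apply: eq_bigr => r _; rewrite /weighted_row !mulr_sumr; apply: eq_bigr => s _.
ring.
Qed.

(** Jensen applied to the numbers [x 0 r * weighted_row (y 0) r]; equality holds when they are all
    equal, which [objective_attained] uses. *)
Let objective_ge x y : admissible (x, y) ->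
  expR (log_objective (y 0)) <= objective (x, y).
Proof.
move=> xyA; rewrite objectiveE//; case: xyA => /= x0 y0.
have xW r : 0 < x 0 r * weighted_row (y 0) r by rewrite mulr_gt0 ?weighted_row_gt0.
have S0 := stochastic_sum_gt0 pS xW.
rewrite -expRD -[X in _ * X]lnK ?posrE// -expRD ler_expR.
apply: le_trans (lerD (lexx _) (sum_mul_ln_le pS xW)).
rewrite [X in _ <= _ + X](eq_bigr (fun r =>
    p 0 r * ln (x 0 r) + p 0 r * ln (weighted_row (y 0) r))).
  by rewrite big_split/= /log_objective; lra.
by move=> r _; rewrite lnM ?posrE ?weighted_row_gt0// mulrDr.
Qed.

Let objective_attained (y : 'I_n -> R) : (forall s, 0 < y s) ->
  objective (\row_r (weighted_row y r)^-1, \row_s y s) = expR (log_objective y).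
Proof.
move=> y0; have W0 := weighted_row_gt0 y0.
have yE : (\row_s y s) 0 = y by apply/funext => s; rewrite mxE.
rewrite objectiveE; last by split => /= i; rewrite mxE ?invr_gt0.
rewrite yE [X in _ * X](eq_bigr (p 0)) => [|r _]; last first.
  by rewrite mxE mulVf ?mulr1// gt_eqF.
rewrite p1 mulr1 -sumrN -expRD /log_objective.
rewrite (eq_bigr (fun r => p 0 r * ln (weighted_row y r))) // => r _.
by rewrite mxE lnV ?posrE// mulrN opprK.
Qed.

Let has_inf_objective : has_inf (objective @` admissible).
Proof.
split.
  exists (expR (log_objective (fun=> 1))), (\row_r (weighted_row (fun=> 1) r)^-1, \row_s 1).
    by split => /= i; rewrite mxE ?invr_gt0 ?weighted_row_gt0.
  by rewrite objective_attained.
exists 0 => _ [[x y] xyA <-]; apply: le_trans (objective_ge xyA); exact: expR_ge0.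
Qed.

Lemma scaling_mean_le y : (forall s, 0 < y s) ->
  scaling_mean p q F <= expR (log_objective y).
Proof.
move=> y0; apply: ge_inf; first by case: has_inf_objective.
exists (\row_r (weighted_row y r)^-1, \row_s y s); last exact: objective_attained.
by split => /= i; rewrite mxE ?invr_gt0 ?weighted_row_gt0.
Qed.

Lemma scaling_mean_adherent (e : R) : 0 < e -> exists2 y, (forall s, 0 < y s) &
  expR (log_objective y) < scaling_mean p q F + e.
Proof.
move=> e0; have [_ [[x y] xyA <-]] := inf_adherent e0 has_inf_objective.
by exists (y 0); [case: xyA|apply: le_lt_trans (objective_ge xyA) _].
Qed.

Lemma scaling_mean_gt0 : 0 < scaling_mean p q F.
Proof.
have [c /andP[c0 c1] cF] := entry_lower_bound.
apply: (lt_le_trans c0); apply: lb_le_inf; first by case: has_inf_objective.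
move=> _ [[x y] xyA <-]; apply: le_trans (objective_ge xyA).
rewrite -[leLHS]lnK ?posrE// ler_expR ln_le_log_objective//.
by case: xyA.
Qed.

(* If shrinking the coordinate [y_s] of a near-minimizer cannot decrease the
   objective by much, then the marginal at [s] exceeds [q_s] by little. *)
Lemma col_marginal_le (y : 'I_n -> R) (e : R) s : (forall s, 0 < y s) ->
  0 < e <= 2^-1 -> log_objective y < ln (scaling_mean p q F) + e ^+ 2 ->
  col_marginal y s <= q 0 s + 3 * e.
Proof.
move=> y0 e01 ymin; have W0 := weighted_row_gt0 y0.
pose y' s' := if s' == s then (1 - e) * y s' else y s'.
have y'0 s' : 0 < y' s' by rewrite /y'; case: eqP => // _; rewrite mulr_gt0//; lra.
have smy' : ln (scaling_mean p q F) <= log_objective y'.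
  by rewrite -[leRHS]expRK ler_ln ?posrE ?scaling_mean_gt0 ?expR_gt0// scaling_mean_le.
have W'E r : weighted_row y' r = weighted_row y r * (1 - e * row_law y r s).
  have -> : weighted_row y r * (1 - e * row_law y r s) =
      weighted_row y r - e * (F r s * q 0 s * y s).
    by rewrite /row_law; field; rewrite gt_eqF.
  rewrite /weighted_row (bigD1 s)//= [in RHS](bigD1 s)//= /y' eqxx.
  rewrite (eq_bigr (fun s' => F r s' * q 0 s' * y s')) => [|s' /negbTE ->//].
  by ring.
have h1 : \sum_r p 0 r * ln (weighted_row y' r) <=
    \sum_r p 0 r * ln (weighted_row y r) - e * col_marginal y s.
  rewrite mulr_sumr -sumrB; apply: ler_sum => r _.
  rewrite mulrCA -mulrBr ler_wpM2l//.
  have := weighted_row_gt0 y'0 r; rewrite W'E pmulr_rgt0// => h.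
  rewrite lnM ?posrE// lerD2l; apply: le_trans (le_ln1Dx _) _ => //.
  by rewrite ltrN2; lra.
have h2 : \sum_s' q 0 s' * ln (y' s') = \sum_s' q 0 s' * ln (y s') + q 0 s * ln (1 - e).
  rewrite (bigD1 s)//= [in RHS](bigD1 s)//= /y' eqxx lnM ?posrE//; last by lra.
  rewrite (eq_bigr (fun s' => q 0 s' * ln (y s'))) => [|s' /negbTE ->//].
  by ring.
(* [ln (1 + u) <= u] at [u = e / (1 - e)], which is at most [e + 2 * e ^+ 2] because [e <= 2^-1]. *)
have h3 : - ln (1 - e) <= e + 2 * e ^+ 2.
  have e1 : 0 < 1 - e by lra.
  rewrite -lnV ?posrE//.
  have -> : (1 - e)^-1 = 1 + e / (1 - e) by field; lra.
  apply: le_trans (le_ln1Dx _) _.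
    by apply: (@lt_le_trans _ _ 0); [lra|apply: divr_ge0; lra].
  by rewrite ler_pdivrMr//; nra.
have qs1 : q 0 s <= 1 by rewrite -q1 (bigD1 s)//= lerDl sumr_ge0.
have h4 := ler_wpM2l (q0 s) h3.
(* Near-minimality contributes [e ^+ 2] and [h4] contributes [q 0 s * (e + 2 * e ^+ 2)]; with
   [q 0 s <= 1] this makes [3 * e]. *)
have : e * col_marginal y s <= e * (q 0 s + 3 * e).
  move: ymin smy' h1 h4 (q0 s) qs1; rewrite /log_objective h2.
  set Q := q 0 s; set L := ln (1 - e); nra.
by rewrite ler_pM2l//; case/andP: e01.
Qed.

(** The bound [c] must not depend on [e], since the tolerance demanded of the marginals will be
    derived from [c]. The marginals sum to 1, so upper bounds on all the others bound each from
    below, and [row_law_ge] passes this to every row. *)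
Lemma near_minimizer : exists2 c : R, 0 < c <= 1 & forall e, 0 < e ->
  exists y, [/\ forall s, 0 < y s,
    log_objective y <= ln (scaling_mean p q F) + e,
    forall s, col_marginal y s <= q 0 s + e &
    forall r s, 0 < q 0 s -> c <= row_law y r s].
Proof.
have [c /andP[c0 c1] cF] := entry_lower_bound.
pose b := \big[Num.min/1]_(s | 0 < q 0 s) q 0 s.
have b0 : 0 < b by rewrite lt_bigmin.
have b1 : b <= 1 by rewrite bigmin_le_id.
have bq s : 0 < q 0 s -> b <= q 0 s by exact: bigmin_le_cond.
have c20 : 0 < c ^+ 2 by rewrite exprn_gt0.
have c21 : c ^+ 2 <= 1 by rewrite exprn_ile1// ltW.
exists (c ^+ 2 * (b / 2)); first by apply/andP; split; [rewrite mulr_gt0 ?divr_gt0|nra].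
move=> e e0; pose N : R := 1 + n%:R.
have N1 : 1 <= N by rewrite lerDl.
(* The three bounds serve [col_marginal_le], the marginal error [3 * d <= e], and the lower bound
   [b / 2] on marginals with [q 0 s > 0]. *)
pose d := Num.min 2^-1 (Num.min (e / 3) (b / (6 * N))).
have d0 : 0 < d by rewrite !lt_min invr_gt0 !divr_gt0 ?mulr_gt0//; lra.
have d2 : d <= 2^-1 by rewrite ge_min lexx.
have de : d <= e / 3 by rewrite !ge_min lexx orbT.
have db : d * (6 * N) <= b.
  by rewrite -ler_pdivlMr ?mulr_gt0//; [rewrite !ge_min lexx !orbT|lra].
have sm0 := scaling_mean_gt0.
(* A slack proportional to the scaling mean is a factor [1 + d ^+ 2], hence at most [d ^+ 2] after
   taking logarithms. *)
have [|y y0 ymin] := @scaling_mean_adherent (scaling_mean p q F * d ^+ 2).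
  by rewrite mulr_gt0 ?exprn_gt0.
have ymin' : log_objective y < ln (scaling_mean p q F) + d ^+ 2.
  rewrite -ltr_expR; apply: (lt_le_trans ymin); rewrite expRD lnK ?posrE//.
  by rewrite -[X in X + _]mulr1 -mulrDr ler_wpM2l ?expR_ge1Dx// ltW.
have dd : 0 < d <= 2^-1 by rewrite d0.
have hm s := @col_marginal_le y d s y0 dd ymin'.
exists y; split => //.
- by apply: ltW; apply: (lt_le_trans ymin'); rewrite lerD2l; nra.
- by move=> s; apply: (le_trans (hm s)); lra.
move=> r s qs; apply: le_trans (row_law_ge y0 r s c0 cF).
rewrite ler_wpM2l 1?ltW//.
have : 1 <= col_marginal y s + (1 - q 0 s + 3 * d * n%:R).
  rewrite -[leLHS](sum_col_marginal y0) (bigD1 s)//= lerD2l.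
  apply: (le_trans (ler_sum _ (fun s' _ => hm s'))); rewrite big_split/=.
  have -> : 1 - q 0 s = \sum_(s' | s' != s) q 0 s'.
    by rewrite -q1 (bigD1 s)//= addrAC subrr add0r.
  rewrite lerD2l.
  rewrite sumr_const -[leLHS]mulr_natr ler_wpM2l ?ler_nat; [by []|lra|].
  by rewrite (leq_trans (max_card _))// card_ord.
have := bq s qs; move: db; rewrite /N; nra.
Qed.

End LogScalingMean.

(** * Perfect matchings of a bipartite graph *)

Section PerfectMatchings.
Variables (n : nat) (x : nat * nat -> bool).

Let edge (i j : 'I_n) : {set 'I_n + 'I_n} := [set inl i; inr j].

Let edge_inl i j a : (inl a \in edge i j) = (a == i).
Proof. by rewrite !inE orbF. Qed.

Let edge_inr i j b : (inr b \in edge i j) = (b == j).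
Proof. by rewrite !inE. Qed.

Let edge_inj i j i' j' : edge i j = edge i' j' -> i = i' /\ j = j'.
Proof.
move=> E; split; apply/eqP.
  by rewrite -(edge_inl i' j') -E edge_inl.
by rewrite -(edge_inr i' j') -E edge_inr.
Qed.

Let matching (sigma : 'S_n) := [set edge i (sigma i) | i : 'I_n].

Let matching_inj : injective matching.
Proof.
move=> sigma tau E; apply/permP => i.
have : edge i (sigma i) \in matching tau by rewrite -E; apply/imsetP; exists i.
by move=> /imsetP[i' _ /edge_inj[-> ->]].
Qed.

Let perfect_matching_of_perm (sigma : 'S_n) : (forall i : 'I_n, x (val i, val (sigma i))) ->
  perfect_matching (bipartite_graph n x) (matching sigma).
Proof.
move=> xs; apply/andP; split.
  apply/fintype.subsetP => _ /imsetP[i _ ->]; apply/imsetP; exists (i, sigma i) => //.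
  by rewrite inE /= xs.
apply/forallP => -[a|b]; apply/cards1P.
  exists (edge a (sigma a)); apply/setP => e; rewrite !inE; apply/andP/eqP.
    by move=> [/imsetP[i _ ->]]; rewrite edge_inl => /eqP ->.
  by move=> ->; rewrite edge_inl; split => //; apply/imsetP; exists a.
exists (edge ((sigma^-1)%g b) b); apply/setP => e; rewrite !inE; apply/andP/eqP.
  by move=> [/imsetP[i _ ->]]; rewrite edge_inr => /eqP ->; rewrite permK.
move=> ->; rewrite edge_inr; split => //; apply/imsetP; exists ((sigma^-1)%g b) => //.
by rewrite permKV.
Qed.

(** Covering each left vertex defines a function [f]; covering each right vertex only once makes it
    injective. *)
Let perm_of_perfect_matching M : perfect_matching (bipartite_graph n x) M ->
  exists2 sigma : 'S_n, (forall i : 'I_n, x (val i, val (sigma i))) & M = matching sigma.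
Proof.
move=> /andP[/fintype.subsetP ME /forallP M1].
have edgeM e : e \in M -> exists i j, e = edge i j /\ x (val i, val j).
  by move=> /ME /imsetP[[i j]]; rewrite inE => xij ->; exists i, j.
have uniqM v e e' : e \in M -> e' \in M -> v \in e -> v \in e' -> e = e'.
  have /cards1P[e0 E] := M1 v => eM e'M ve ve'.
  have : e \in [set e0] by rewrite -E inE eM.
  have : e' \in [set e0] by rewrite -E inE e'M.
  by rewrite !inE => /eqP -> /eqP.
have [f fM] : exists f : 'I_n -> 'I_n, forall i, (edge i (f i) \in M) && x (val i, val (f i)).
  suff : forall i, exists j, (edge i j \in M) && x (val i, val j).
    by move=> /fin_all_exists.
  move=> i; have /cards1P[e E] := M1 (inl i).
  have : e \in [set e' in M | inl i \in e'] by rewrite E inE.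
  rewrite inE => /andP[eM]; have [a [b [Ee xab]]] := edgeM e eM.
  by move: eM; rewrite Ee edge_inl => eM /eqP ->; exists b; rewrite eM.
have f_inj : injective f.
  move=> i i' ff; have /andP[iM _] := fM i; have /andP[i'M _] := fM i'.
  suff /edge_inj[] : edge i (f i) = edge i' (f i') by [].
  by apply: (uniqM (inr (f i))); rewrite // edge_inr ?ff.
exists (perm f_inj) => [i|]; first by rewrite permE; case/andP: (fM i).
apply/setP => e; apply/idP/imsetP => [eM|[i _ ->]]; last by rewrite permE; case/andP: (fM i).
have [a [b [Ee _]]] := edgeM e eM; exists a => //; rewrite permE.
have /andP[aM _] := fM a.
by apply: (uniqM (inl a)); rewrite // ?Ee edge_inl.
Qed.

Lemma pm_bipartite_graph : pm (bipartite_graph n x) =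
  #|[set sigma : 'S_n | [forall i : 'I_n, x (val i, val (sigma i))]]|.
Proof.
rewrite -(card_imset _ matching_inj); apply: eq_card => M.
rewrite inE; apply/idP/imsetP => [/perm_of_perfect_matching[sigma xs ->]|[sigma]].
  by exists sigma => //; rewrite inE; apply/forallP.
by rewrite inE => /forallP xs ->; exact: perfect_matching_of_perm.
Qed.

End PerfectMatchings.

(** * The limit along sequences with given frequencies *)

Local Open Scope classical_set_scope.
Local Open Scope ring_scope.

Definition has_frequencies (R : realType) (m : nat) (a : 'rV[R]_m) (w : nat -> 'I_m) :=
  forall s, (\sum_(i < N) (w i == s)%:R) / N%:R @[N --> \oo] --> a 0 s.

(** Grouping positions by letter turns the average into a finite combination of letter
    frequencies. *)
Lemma average_cvg (R : realType) (m : nat) (a : 'rV[R]_m) (w : nat -> 'I_m)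
    (h : 'I_m -> R) : has_frequencies a w ->
  (\sum_(i < N) h (w i)) / N%:R @[N --> \oo] --> \sum_s a 0 s * h s.
Proof.
move=> aw; have -> : (fun N : nat => (\sum_(i < N) h (w i)) / N%:R) =
    (fun N => \sum_s (\sum_(i < N) (w i == s)%:R) / N%:R * h s).
  apply/funext => N; under [RHS]eq_bigr do rewrite mulrAC.
  rewrite -mulr_suml; congr (_ / _); under [RHS]eq_bigr do rewrite mulr_suml.
  rewrite exchange_big/=; apply: eq_bigr => i _.
  rewrite (bigD1 (w i))//= eqxx mul1r big1 ?addr0// => s.
  by rewrite eq_sym => /negbTE ->; rewrite mul0r.
apply: cvg_big => [|s _]; first exact: add_continuous.
exact: cvgMr_tmp.
Qed.

Section Deterministic.
Variables (R : realType) (m n : nat).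
Variables (p : 'rV[R]_m) (q : 'rV[R]_n) (F : 'M[R]_(m, n)).
Hypotheses (pS : stochastic p) (qS : stochastic q).
Hypothesis F01 : forall r s, 0 < F r s <= 1.
Variables (w : nat -> 'I_m) (v : nat -> 'I_n).
Hypotheses (wp : has_frequencies p w) (vq : has_frequencies q v).
Hypothesis v0 : forall j, 0 < q 0 (v j).

Definition mean_permanent (N : nat) : R :=
  (\sum_(sigma : 'S_N) \prod_(i < N) F (w i) (v (sigma i))) / (N`!)%:R.

Let psi N : {ffun 'I_N -> 'I_n} := [ffun i : 'I_N => v i].

Let occE N s : (occ (psi N) s)%:R = \sum_(j < N) (v j == s)%:R :> R.
Proof. by rewrite natr_sum; apply: eq_bigr => i _; rewrite ffunE. Qed.

Let product_law N (rho : 'I_N -> 'I_n -> R) :=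
  \sum_(g | rearrangement g (psi N)) product_weight rho g.

Let product_law_le1 N rho : stochastic_kernel rho -> @product_law N rho <= 1.
Proof.
move=> rhoK; rewrite -(sum_product_weight rhoK) [leRHS](bigID (fun g => rearrangement g (psi N)))/=.
by rewrite lerDl; apply: sumr_ge0 => f _; apply: product_weight_ge0; case: rhoK.
Qed.

(** Insert [F r s = row_law r s * weighted_row r / (q s * y s)] into [permanent_ratio]. The second
    factor is written with averages, to which [average_cvg] applies. *)
Let mean_permanentE N y : (forall s, 0 < y s) -> (0 < N)%N ->
  mean_permanent N =
  product_law (fun i : 'I_N => row_law q F y (w i)) / @product_law N (fun=> q 0) *
  expR (((\sum_(i < N) ln (weighted_row q F y (w i))) / N%:R -
         (\sum_(j < N) ln (y (v j))) / N%:R) * N%:R).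
Proof.
move=> y0 N0; have W0 := weighted_row_gt0 qS F01 y0.
have psiq (j : 'I_N) : 0 < q 0 (psi N j) by rewrite ffunE.
have := permanent_ratio (fun i : 'I_N => row_law q F y (w i))
  (fun i : 'I_N => weighted_row q F y (w i)) y psiq.
have N0' : N%:R != 0 :> R by rewrite pnatr_eq0 -lt0n.
rewrite -mulrBl divfK// expRB !expR_sum.
rewrite [X in _ = _ -> _ = _ * (X / _)](eq_bigr (fun i : 'I_N =>
    weighted_row q F y (w i))) => [|i _]; last first.
  by rewrite lnK ?posrE.
rewrite [X in _ = _ -> _ = _ * (_ / X)](eq_bigr (fun j => y (psi N j))) => [<-|j _]; last first.
  by rewrite ffunE lnK ?posrE.
rewrite /mean_permanent; congr (_ / _); apply: eq_bigr => sigma _.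
apply: eq_bigr => i _; rewrite /row_law !ffunE divfK ?gt_eqF//.
by rewrite -(mulrA (F _ _)) mulfK// mulf_neq0// gt_eqF.
Qed.

(** Near-minimality of [y], convergence of the averages, and each of the two rearrangement
    probabilities cost at most [e / 4]. *)
Lemma mean_permanent_bounds (e : R) : 0 < e -> \forall N \near \oo,
  expR ((ln (scaling_mean p q F) - e) * N%:R) <= mean_permanent N <=
  expR ((ln (scaling_mean p q F) + e) * N%:R).
Proof.
move=> e0.
have [c1 /andP[c10 c11] near_min] := near_minimizer pS qS F01.
pose c2 := \big[Num.min/1]_(s | 0 < q 0 s) q 0 s.
(* One lower bound for the letter probabilities under both the row laws and [q]. *)
pose c := Num.min c1 c2.
have c20 : 0 < c2 by rewrite lt_bigmin.
have c01 : 0 < c <= 1 by rewrite lt_min c10 c20 ge_min c11.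
have e40 : 0 < e / 4 by rewrite divr_gt0.
have [d d0 [N0 weight_ge]] := rearrangement_weight_ge_exp 'I_n c01 e40.
(* Only now is [y] chosen, with [d] known. Half of [d] goes to the marginals of [y], a quarter to
   each of the two empirical frequencies. *)
have [|y [y0 ymin ymarg yc]] := near_min (Num.min (e / 4) (d / 2)).
  by rewrite lt_min !divr_gt0.
have W0 := weighted_row_gt0 qS F01 y0.
have ymin' : log_objective p q F y <= ln (scaling_mean p q F) + e / 4.
  by apply: (le_trans ymin); rewrite lerD2l ge_min lexx.
have ymarg' s : col_marginal p q F y s <= q 0 s + d / 2.
  by apply: (le_trans (ymarg s)); rewrite lerD2l ge_min lexx orbT.
have sm0 := scaling_mean_gt0 pS qS F01.
have objge : ln (scaling_mean p q F) <= log_objective p q F y.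
  by rewrite -[leRHS]expRK ler_ln ?posrE ?expR_gt0// scaling_mean_le.
have cvg_obj : (\sum_(i < N) ln (weighted_row q F y (w i))) / N%:R -
    (\sum_(j < N) ln (y (v j))) / N%:R @[N --> \oo] --> log_objective p q F y.
  exact: (cvgB (@average_cvg _ _ _ _ (fun r => ln (weighted_row q F y r)) wp)
               (@average_cvg _ _ _ _ (fun s => ln (y s)) vq)).
have occ0 N s : (0 < occ (psi N) s)%N -> 0 < q 0 s.
  rewrite lt0n /occ sum_nat_eq0 negb_forall => /existsP[i].
  by rewrite /= eqb0 negbK ffunE => /eqP <-.
have d40 : 0 < d / 4 by rewrite divr_gt0.
near=> N.
have Ngt0 : (0 < N)%N by near: N; exact: nbhs_infty_gt.
have NR0 : 0 < N%:R :> R by rewrite ltr0n.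
have NR1 : N%:R != 0 :> R by rewrite gt_eqF.
have N0N : N0 <= #|'I_N|%:R by rewrite card_ord; near: N; exact: nbhs_infty_ger.
have occ_ge s : q 0 s <= (occ (psi N) s)%:R / N%:R + d / 4.
  rewrite -lerBlDr occE; move: s; near: N; apply: filter_forall => s.
  by apply: (cvgr_ge _ (@vq s)); rewrite ltrBlDr ltrDl.
have marg_le s : (\sum_(i < N) row_law q F y (w i) s) / N%:R <= col_marginal p q F y s + d / 4.
  move: s; near: N; apply: filter_forall => s.
  by apply: (cvgr_le _ (@average_cvg _ _ _ _ (fun r => row_law q F y r s) wp)); rewrite ltrDl.
have obj_le : (\sum_(i < N) ln (weighted_row q F y (w i))) / N%:R -
    (\sum_(j < N) ln (y (v j))) / N%:R <= log_objective p q F y + e / 4.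
  by near: N; apply: (cvgr_le _ cvg_obj); rewrite ltrDl.
have obj_ge : log_objective p q F y - e / 4 <= (\sum_(i < N) ln (weighted_row q F y (w i))) / N%:R -
    (\sum_(j < N) ln (y (v j))) / N%:R.
  by near: N; apply: (cvgr_ge _ cvg_obj); rewrite ltrBlDr ltrDl.
have rhoK : stochastic_kernel (fun i : 'I_N => row_law q F y (w i)).
  by split => i; [exact: row_law_ge0|exact: sum_row_law].
have qK : stochastic_kernel (fun i : 'I_N => q 0) by case: qS.
have rho_le := product_law_le1 rhoK.
have q_le := product_law_le1 qK.
have rho_ge : expR (- (e / 4) * N%:R) <= product_law (fun i : 'I_N => row_law q F y (w i)).
  have := weight_ge _ (fun i : 'I_N => row_law q F y (w i)) (psi N) N0N rhoK.
  rewrite card_ord; apply; first by move=> i s /occ0 qs; rewrite ge_min yc.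
  move=> s.
  rewrite -(divfK NR1 (\sum_i _)) -(divfK NR1 (occ _ _)%:R) -mulrDl.
  rewrite ler_pM2r//; have := occ_ge s; have := marg_le s; have := ymarg' s; lra.
have q_ge : expR (- (e / 4) * N%:R) <= @product_law N (fun=> q 0).
  have := weight_ge _ (fun _ : 'I_N => q 0) (psi N) N0N qK.
  rewrite card_ord; apply.
    by move=> i s /occ0 qs; rewrite ge_min [X in _ || X]bigmin_le_cond ?orbT.
  move=> s; rewrite sumr_const card_ord -[leLHS]mulr_natr.
  rewrite -(divfK NR1 (occ _ _)%:R) -mulrDl.
  rewrite ler_pM2r//; have := occ_ge s; lra.
rewrite (mean_permanentE y0)//; move: rho_le rho_ge q_le q_ge obj_le obj_ge.
set Prho := product_law _; set Pq := product_law _; set phi := _ - _.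
move=> rho_le rho_ge q_le q_ge obj_le obj_ge.
have Pq0 : 0 < Pq by apply: lt_le_trans q_ge; exact: expR_gt0.
apply/andP; split.
  apply: (@le_trans _ _ (expR (- (e / 4) * N%:R) * expR (phi * N%:R))).
    by rewrite -expRD ler_expR -mulrDl ler_pM2r//; lra.
  rewrite ler_pM2r ?expR_gt0// ler_pdivlMr//.
  by apply: le_trans rho_ge; rewrite ler_piMr// expR_ge0.
apply: (@le_trans _ _ (expR (e / 4 * N%:R) * expR (phi * N%:R))); last first.
  by rewrite -expRD ler_expR -mulrDl ler_pM2r//; lra.
rewrite ler_pM2r ?expR_gt0// ler_pdivrMr//; apply: (le_trans rho_le).
apply: le_trans (ler_wpM2l (expR_ge0 _) q_ge).
by rewrite -expRD mulNr subrr expR0.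
Unshelve. all: by end_near. Qed.

Lemma mean_permanent_root_cvg :
  mean_permanent N `^ N%:R^-1 @[N --> \oo] --> scaling_mean p q F.
Proof.
have sm0 := scaling_mean_gt0 pS qS F01.
have : expR (ln (mean_permanent N) / N%:R) @[N --> \oo] --> expR (ln (scaling_mean p q F)).
  apply: continuous_cvg; first exact: continuous_expR.
  apply/cvgrPdist_le => e e0; near=> N.
  have /andP[] : expR ((ln (scaling_mean p q F) - e) * N%:R) <= mean_permanent N <=
      expR ((ln (scaling_mean p q F) + e) * N%:R).
    by near: N; exact: mean_permanent_bounds.
  have NR0 : 0 < N%:R :> R by rewrite ltr0n; near: N; exact: nbhs_infty_gt.
  move=> ge le; have P0 : 0 < mean_permanent N by apply: lt_le_trans ge; exact: expR_gt0.
  rewrite ler_distlC ler_pdivlMr// ler_pdivrMr//.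
  by rewrite -ler_expR lnK ?posrE// ge -ler_expR lnK ?posrE.
(* [powR] is the exponential of a multiple of the logarithm only for a nonzero base, so positivity
   is needed for large [N]. *)
rewrite lnK ?posrE//; apply: cvg_trans; apply: near_eq_cvg; near=> N.
have /andP[ge _] : expR ((ln (scaling_mean p q F) - 1) * N%:R) <= mean_permanent N <=
      expR ((ln (scaling_mean p q F) + 1) * N%:R).
  by near: N; exact: mean_permanent_bounds.
have P0 : 0 < mean_permanent N by apply: lt_le_trans ge; exact: expR_gt0.
by rewrite /powR gt_eqF// mulrC.
Unshelve. all: by end_near. Qed.

End Deterministic.

(** * Almost sure frequencies *)

Section AlmostSureFrequencies.
Variables (R : realType) (k : nat) (p : 'rV[R]_k.+1).
Variable mu : probability (seq_space k) R.
Hypotheses (pS : stochastic p) (mup : is_product_measure p mu).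

Let prefix_word n (w : seq_space k) : {ffun 'I_n -> 'I_k.+1} := [ffun i : 'I_n => w i].

Let cylinder n (f : {ffun 'I_n -> 'I_k.+1}) : set (seq_space k) :=
  [set w | prefix_word n w = f].

Lemma measurable_coordinate i c : measurable ([set w | w i = c] : set (seq_space k)).
Proof. by apply: sub_sigma_algebra; exists i => //; exists c. Qed.

Let measurable_cylinder n f : measurable (@cylinder n f).
Proof.
have -> : cylinder f = \bigcap_(i in [set: 'I_n]) [set w : seq_space k | w i = f i].
  apply/seteqP; split => w; first by move=> <- i _; rewrite /= ffunE.
  by move=> wf; apply/ffunP => i; rewrite ffunE; exact: wf.
apply: fin_bigcap_measurable => [|i _]; first exact: finite_finset.
exact: measurable_coordinate.
Qed.

Let mu_cylinder n f : mu (@cylinder n f) = (product_weight (fun=> p 0) f)%:E.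
Proof.
(* The default value beyond [n] is arbitrary: only indices below [n] are constrained. *)
pose A i : {set 'I_k.+1} := if insub i is Some j then [set f j]%SET else [set: 'I_k.+1]%SET.
have := mup n A; rewrite (_ : [set w | _] = cylinder f); last first.
  apply/seteqP; split => w /=.
    move=> wA; apply/ffunP => i; rewrite ffunE; have := wA i (ltn_ord i).
    by rewrite /A valK inE => /eqP.
  by rewrite /cylinder/= => wf i ilt; rewrite /A insubT inE -wf ffunE.
move=> ->; congr (_%:E); apply: eq_bigr => i _.
by rewrite /A valK big_set1.
Qed.

Let measure_bigsetU_le (I : Type) (r : seq I) (P : pred I) (D : I -> set (seq_space k)) :
  (forall i, measurable (D i)) ->
  (mu (\big[setU/set0]_(i <- r | P i) D i) <= \sum_(i <- r | P i) mu (D i))%E.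
Proof.
move=> mD; elim: r => [|i r IH]; first by rewrite !big_nil measure0.
rewrite !big_cons; case: ifP => // _; apply: (le_trans (measureU2 _ _ _)) => //.
  by apply: bigsetU_measurable.
by rewrite leeD2l.
Qed.

(** Spelled like the event in [chernoff_occ], so that the finite bound transfers to [mu] through
    cylinders. *)
Let excess n s (e : R) : set (seq_space k) :=
  [set w | \sum_(i < n) p 0 s + e * #|'I_n|%:R <= (occ (prefix_word n w) s)%:R].

Let excessE n s e : excess n s e =
  \big[setU/set0]_(f | \sum_(i < n) p 0 s + e * #|'I_n|%:R <= (occ f s)%:R)
     @cylinder n f.
Proof.
apply/seteqP; split => [w wE|w].
  by rewrite (bigD1 (prefix_word n w))//; left.
elim/big_rec: _ => // f U fE IH [|//]; by rewrite /excess /cylinder/= => ->.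
Qed.

Let measurable_excess n s e : measurable (excess n s e).
Proof. by rewrite excessE; apply: bigsetU_measurable. Qed.

Let mu_excess n s (e : R) : 0 <= e <= 1 ->
  (mu (excess n s e) <= (expR (- (e ^+ 2 / 8)) ^+ n)%:E)%E.
Proof.
move=> e01; rewrite excessE; apply: (le_trans (measure_bigsetU_le _ _ _)) => //.
under eq_bigr do rewrite mu_cylinder.
rewrite sumEFin lee_fin -expRM_natr.
have pK : stochastic_kernel (fun _ : 'I_n => p 0) by case: pS.
by have := chernoff_occ s pK e01; rewrite card_ord mulNr.
Qed.

(** Borel-Cantelli: the Chernoff bounds are terms of a convergent geometric series. *)
Let ae_eventually_not_excess s (e : R) : 0 < e <= 1 ->
  {ae mu, forall w, \forall n \near \oo, ~ excess n s e w}.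
Proof.
move=> /andP[e0 e1]; set x := expR (- (e ^+ 2 / 8)).
have x0 : 0 < x by exact: expR_gt0.
have x1 : x < 1 by rewrite expR_lt1; have := exprn_gt0 2 e0; lra.
have lim0 : mu (lim_sup_set (fun n => excess n s e)) = 0.
  apply: lim_sup_set_cvg0 => //.
  apply: (@le_lt_trans _ _ ((1 - x)^-1)%:E); last exact: ltry.
  apply: lime_le; first exact: is_cvg_nneseries.
  apply: nearW => n; apply: (@le_trans _ _ (\sum_(0 <= i < n) (x ^+ i)%:E)%E).
    by apply: lee_sum => i _; apply: mu_excess; rewrite ltW.
  rewrite sumEFin lee_fin -[leRHS]div1r ler_pdivlMr ?subr_gt0//.
  have := subrX1 x n; rewrite -(big_mkord predT (fun i => x ^+ i)).
  by have := exprn_ge0 n (ltW x0); set S := \sum_(_ <= _ < _) _; nra.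
exists (lim_sup_set (fun n => excess n s e)); split => //.
  apply: bigcapT_measurable => n; exact: bigcup_measurable.
move=> w /= nw n _; apply: contrapT => h; apply: nw; exists n => // j nj wj.
by apply: h; exists j.
Qed.

Let ae_support : {ae mu, forall w : seq_space k, forall i, 0 < p 0 (w i)}.
Proof.
apply: ae_foralln => i.
suff : {ae mu, forall w : seq_space k, forall c, p 0 c = 0 -> w i <> c}.
  apply: filterS => w h; rewrite lt_neqAle (pS.1 _) andbT.
  by apply/eqP => /esym/h.
apply: filter_forall => c; have [pc|pc] := eqVneq (p 0 c) 0; last first.
  by apply: aeW => w pc'; rewrite pc' eqxx in pc.
exists [set w : seq_space k | w i = c]; split; first exact: measurable_coordinate.
  (* Only coordinate [i] is constrained, so the last factor of the product is [p 0 c = 0]. *)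
  have := mup i.+1 (fun j => if j == i then [set c]%SET else [set: 'I_k.+1]%SET).
  rewrite big_ord_recr/= eqxx big_set1 pc mulr0 => E0; apply: etrans E0; congr (mu _).
  apply/seteqP; split => w /=.
    by move=> wc j _; case: eqP => [->|_]; rewrite inE ?wc.
  by move=> /(_ i (ltnSn i)); rewrite eqxx inE => /eqP.
by move=> w /= h; apply: contrapT => wc; apply: h.
Qed.

(** Upper deviations suffice: frequencies sum to 1, so if each exceeds its limit by at most [e / K],
    with [K] the number of letters, none falls short by more than [e]. Tolerances [1 / (j + 1)] keep
    the exceptional sets countable in number. *)
Lemma ae_has_frequencies :
  {ae mu, forall w : seq_space k, has_frequencies p w /\ forall i, 0 < p 0 (w i)}.
Proof.
have ae_all : {ae mu, forall w, forall (s : 'I_k.+1) j, \forall n \near \oo,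
    ~ excess n s j.+1%:R^-1 w}.
  apply: filter_forall => s; apply: ae_foralln => j.
  by apply: ae_eventually_not_excess; rewrite invr_gt0 ltr0n invf_le1 ?ltr0n// ler1n.
apply: filterS2 ae_all ae_support => w not_exc supp; split => // s.
apply/cvgrPdist_le => e e0.
pose K : R := k.+1%:R.
have K1 : 1 <= K by rewrite ler1n.
have eK : 0 < e / K by rewrite divr_gt0//; lra.
have [j je] : exists j : nat, j.+1%:R^-1 <= e / K.
  exists (Num.bound (e / K)^-1); rewrite -[leRHS]invrK lef_pV2 ?posrE ?invr_gt0//.
  apply/ltW/(lt_le_trans (archi_boundP _)); first by rewrite invr_ge0 ltW.
  by rewrite ler_nat.
have {}not_exc : \forall n \near \oo, forall s, ~ excess n s j.+1%:R^-1 w.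
  by apply: filter_forall => s'; exact: not_exc.
near=> n.
have n0 : 0 < n%:R :> R by rewrite ltr0n; near: n; exact: nbhs_infty_gt.
have upper s' : (\sum_(i < n) (w i == s')%:R) / n%:R <= p 0 s' + e / K.
  have /(_ s') : forall s, ~ excess n s j.+1%:R^-1 w by near: n.
  rewrite /excess/= card_ord sumr_const card_ord => /negP; rewrite -ltNge => h.
  have occE : (occ (prefix_word n w) s')%:R = \sum_(i < n) (w i == s')%:R :> R.
    by rewrite natr_sum; apply: eq_bigr => i _; rewrite ffunE.
  rewrite ler_pdivrMr// -occE; apply: (le_trans (ltW h)).
  by rewrite -[p 0 s' *+ n]mulr_natr -mulrDl ler_pM2r// lerD2l.
have total : \sum_s' (\sum_(i < n) (w i == s')%:R) / n%:R = 1 :> R.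
  rewrite -mulr_suml exchange_big/=; apply: (@mulIf _ n%:R); first by rewrite gt_eqF.
  rewrite mulfVK ?gt_eqF// mul1r -[in RHS](card_ord n) -sum1_card natr_sum.
  apply: eq_bigr => i _; rewrite (bigD1 (w i))//= eqxx big1 ?addr0// => s'.
  by rewrite eq_sym => /negbTE ->.
have eKle : e / K <= e by rewrite ler_pdivrMr; [rewrite ler_peMr// ltW|lra].
rewrite ler_distlC; apply/andP; split; last by apply: (le_trans (upper s)); rewrite lerD2l.
have : \sum_(s' | s' != s) (\sum_(i < n) (w i == s')%:R) / n%:R <=
    \sum_(s' | s' != s) p 0 s' + e.
  apply: (@le_trans _ _ (\sum_(s' | s' != s) (p 0 s' + e / K))).
    by apply: ler_sum.
  have K0 : K != 0 by rewrite pnatr_eq0.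
  rewrite big_split/= lerD2l sumr_const -[leLHS]mulr_natr -[leRHS](divfK K0).
  by rewrite (ler_wpM2l (ltW eK))// ler_nat (leq_trans (max_card _))// card_ord.
have : \sum_(s' | s' != s) p 0 s' = 1 - p 0 s.
  by rewrite -pS.2 [in RHS](bigD1 s)//= addrAC subrr add0r.
move: total; rewrite (bigD1 s)//=; lra.
Unshelve. all: by end_near. Qed.

End AlmostSureFrequencies.

(** * The expected number of perfect matchings *)

(** The count is a sum of indicators over permutations; linearity and independence of the edges of
    each matching give the permanent. *)
Lemma expected_pmE (R : realType) (d : measure_display) (T : measurableType d)
    (P : probability T R) (X : nat * nat -> {RV P >-> bool})
    (a : nat -> nat -> R) (n : nat) :
  mutually_independent X -> (forall i j, 0 <= a i j <= 1) ->
  (forall i j, distribution P (X (i, j)) =1 bernoulli_prob (a i j)) ->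
  expected_pm X n = (\sum_(sigma : 'S_n) \prod_(i < n) a i (sigma i))%:E.
Proof.
move=> indep a01 law.
pose present (sigma : 'S_n) : set T :=
  [set t | forall i : 'I_n, X (val i, val (sigma i)) t].
have presentE sigma : present sigma =
    \bigcap_(i in [set: 'I_n]) (X (val i, val (sigma i)) @^-1` [set true]).
  by apply/seteqP; split => t /= h i; [move=> _; exact: h|exact: (h i)].
have mpresent sigma : measurable (present sigma).
  rewrite presentE; apply: fin_bigcap_measurable => [|i _]; first exact: finite_finset.
  by rewrite -[X in measurable X]setTI; exact: measurable_funP.
have P_edge i j : P (X (i, j) @^-1` [set true]) = (a i j)%:E.
  have := law i j [set true]; rewrite /distribution /pushforward => ->.
  by rewrite bernoulli_probE// !diracE mem_set// memNset//= mule1 mule0 adde0.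
have P_present sigma : P (present sigma) = (\prod_(i < n) a i (sigma i))%:E.
  pose J : {fset nat * nat} := [fset (val i, val (sigma i)) | i in 'I_n]%fset.
  have := indep J (fun=> [set true]) (fun=> I).
  rewrite (_ : [set t | _] = present sigma) => [->|]; last first.
    apply/seteqP; split => t /= h.
      by move=> i; apply: (h (val i, val (sigma i))); apply/imfsetP; exists i.
    by move=> _ /imfsetP[i _ ->]; exact: h.
  (* The edges of one matching are distinct, having distinct left endpoints. *)
  rewrite big_imfset/= => [|i i' _ _ [/val_inj]//].
  rewrite big_enum/= -prodEFin; apply: eq_bigr => i _; exact: P_edge.
transitivity (\int[P]_t \sum_(sigma : 'S_n) (\1_(present sigma) t)%:E)%E.
  rewrite /expected_pm unlock; apply: eq_integral => t _.
  rewrite sumEFin pm_bipartite_graph -sum1_card natr_sum big_mkcond/=.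
  congr (_%:E); apply: eq_bigr => sigma _; rewrite inE indicE.
  case: forallP => h; first by rewrite mem_set.
  by rewrite memNset.
rewrite ge0_integral_sum//; last first.
  by move=> sigma; by apply/measurable_EFinP; exact: measurable_indic.
rewrite -sumEFin; apply: eq_bigr => sigma _.
by rewrite integral_indic// setIT; exact: P_present.
Qed.

(** The exceptional set lies in two null strips, one over each factor. *)
Lemma ae_product (R : realType) (d1 d2 : measure_display)
    (T1 : measurableType d1) (T2 : measurableType d2)
    (m1 : probability T1 R) (m2 : probability T2 R) (A : T1 -> Prop) (B : T2 -> Prop) :
  {ae m1, forall x, A x} -> {ae m2, forall y, B y} ->
  {ae (m1 \x m2)%E, forall z, A z.1 /\ B z.2}.
Proof.
move=> [N1 [mN1 N10 AN1]] [N2 [mN2 N20 BN2]].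
have [N [mN N0 UN]] : (m1 \x m2)%E.-negligible ((N1 `*` setT) `|` (setT `*` N2)).
  apply: negligibleU; apply/negligibleP; do ?exact: measurableX.
    by transitivity (m1 N1 * m2 setT)%E; [exact: product_measure1E|rewrite N10 mul0e].
  by transitivity (m1 setT * m2 N2)%E; [exact: product_measure1E|rewrite N20 mule0].
exists N; split => // -[x y] /= /not_andP[nA|nB]; apply: UN.
  by left; split => //; exact: AN1.
by right; split => //; exact: BN2.
Qed.

Theorem theorem3p2 (R : realType) (k l : nat)
    (p : 'rV[R]_k.+1) (q : 'rV[R]_l.+1) (F : 'M[R]_(k.+1, l.+1))
    (muW : probability (seq_space k) R) (muM : probability (seq_space l) R)
    (d : measure_display) (T : environment k l -> measurableType d)
    (P : forall w : environment k l, probability (T w) R)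
    (X : forall w : environment k l, nat * nat -> {RV (P w) >-> bool}) :
  stochastic p -> stochastic q ->
  (forall r s, 0 <= F r s <= 1) ->
  is_product_measure p muW -> is_product_measure q muM ->
  (forall w, mutually_independent (X w)) ->
  (forall w i j, distribution (P w) (X w (i, j))
                   =1 bernoulli_prob (edge_prob F w i j)) ->
  (forall r s, 0 < F r s) ->
  {ae (muW \x muM)%E, forall w : environment k l,
     (fine (expected_pm (X w) n) / (n`!)%:R) `^ (n%:R)^-1 @[n --> \oo]
       --> scaling_mean p q F}.
Proof.
move=> pS qS F01 muWp muMq indep law F0.
have F01' r s : 0 < F r s <= 1 by rewrite F0; case/andP: (F01 r s).
apply: filterS (ae_product (ae_has_frequencies pS muWp) (ae_has_frequencies qS muMq)).
move=> w [[wp _] [vq v0]].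
(* The environment is now fixed, and the statement becomes the deterministic one along [w.1] and
   [w.2]. *)
have -> : (fun n => (fine (expected_pm (X w) n) / (n`!)%:R) `^ (n%:R)^-1) =
    (fun n => mean_permanent F w.1 w.2 n `^ (n%:R)^-1).
  apply/funext => n.
  by rewrite (expected_pmE n (indep w) (fun i j => F01 _ _) (law w)).
exact: mean_permanent_root_cvg.
Qed.
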